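(* Let $1\le \ell_1\le\dots\le\ell_r\le n$ and $T\in B(\varpi_{\ell_r})\otimes\cdots\otimes B(\varpi_{\ell_1})$. (a) If $T$ is not semistandard, then $\Psi_T=0$. (b) For every $\ell\in[n]$ with $\ell\ge \ell_r$, in $H$ one has $$\Psi_T\,X^{\varpi_\ell}=\sum_{C\in B(\varpi_\ell)}X^{C}\,\Psi_{C\otimes T}.$$ (c) For every $\lambda\in(\mathbb Z^n_{\ge0})_+$, $$\mathbf 1_0\,X^{\lambda}=\sum_{T\in B(\lambda)}X^{T}\,\Psi_T .$$
   Context: Fix $n\ge1$, $[n]=\{1,\dots,n\}$. $S_n$ is the symmetric group with simple transpositions $s_i=(i,i+1)$, $i\in[n-1]$, and length function $\ell(\cdot)$. $S_n$ acts on $\mathbb Z^n$ by permuting coordinates; $\varepsilon_1,\dots,\varepsilon_n$ is the standard basis, $(\cdot,\cdot)$ the bilinear form with $(\varepsilon_i,\varepsilon_j)=\delta_{ij}$, $\alpha_i=\varepsilon_i-\varepsilon_{i+1}$, and $\varpi_k=\varepsilon_1+\dots+\varepsilon_k$ for $k\in[n]$. $(\mathbb Z^n_{\ge0})_+=\{\lambda\in\mathbb Z^n_{\ge0}:\lambda_1\ge\dots\ge\lambda_n\}$. For $\lambda\in\mathbb Z^n$, $S_{n,\lambda}=\{w\in S_n:w\lambda=\lambda\}$. The affine Hecke algebra $H$ is the $\mathbb Z[t^{\pm1}]$-algebra with generators $T_1,\dots,T_{n-1},X_1^{\pm1},\dots,X_n^{\pm1}$ and relations $T_i^2=(t-1)T_i+t$,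 $T_iT_{i+1}T_i=T_{i+1}T_iT_{i+1}$, $T_iT_j=T_jT_i$ for $|i-j|>1$, $X_iX_j=X_jX_i$, $T_iX_iT_i=tX_{i+1}$, and $T_iX_j=X_jT_i$ for $j\notin\{i,i+1\}$ (so $T_i$ is invertible, $tT_i^{-1}=T_i+1-t$). For $w\in S_n$ with reduced expression $w=s_{i_1}\cdots s_{i_m}$, $T_w=T_{i_1}\cdots T_{i_m}$ (well defined). For $\mu\in\mathbb Z^n$, $X^\mu=X_1^{\mu_1}\cdots X_n^{\mu_n}$. $H_n$ is the subalgebra generated by $T_1,\dots,T_{n-1}$, with basis $\{T_w\}_{w\in S_n}$; for $\lambda\in\mathbb Z^n$, $H_{n,\lambda}$ is the $\mathbb Z[t^{\pm1}]$-span of $\{T_w:w\in S_{n,\lambda}\}$, $\mathbf 1_\lambda=\sum_{w\in S_{n,\lambda}}T_w$, and $\mathbf 1_0=\sum_{w\in S_n}T_w$. Columns: a column of length $\ell$ is $C=(c_1,\dots,c_\ell)$ with $1\le c_1<\dots<c_\ell\le n$ (identified with the subset $\{c_1,\dots,c_\ell\}$); $B(\varpi_\ell)$ is the set of these. If $[n]\setminus C=\{c^c_{\ell+1}<\dots<c^c_n\}$, $u_C\in S_n$ is the permutation with $u_C(k)=c_k$ for $k\le \ell$ and $u_C(k)=c^c_k$ for $k>\ell$. $X^C=X_{c_1}\cdots X_{c_\ell}$. The column $(1,\dots,\ell)$ is called highest weight. Tableaux: for $1\le\ell_1\le\dots\le\ell_r\le n$, $B(\varpi_{\ell_r})\otimes\cdots\otimes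 B(\varpi_{\ell_1})$ is the set of $T=C_r\otimes\cdots\otimes C_1$ with $C_i\in B(\varpi_{\ell_i})$, viewed as a filling of the Young diagram of $\lambda=\varpi_{\ell_r}+\dots+\varpi_{\ell_1}$ with columns $C_r,\dots,C_1$ from left to right (each written top to bottom). $T$ is semistandard if entries weakly increase along each row from left to right. Every $\lambda\in(\mathbb Z^n_{\ge0})_+$ is uniquely $\varpi_{\ell_r}+\dots+\varpi_{\ell_1}$ with $\ell_1\le\dots\le\ell_r$ (column lengths); $B(\lambda)\subseteq B(\varpi_{\ell_r})\otimes\cdots\otimes B(\varpi_{\ell_1})$ is the set of semistandard ones. $X^T=\prod_i X^{C_i}$. For $C\in B(\varpi_\ell)$ with $\ell\ge\ell_r$, $C\otimes T$ means $C\otimes C_r\otimes\cdots\otimes C_1$. Definition of $\Psi$: every $h\in H_n$ can be written uniquely as $h=\sum_{F\in B(\varpi_\ell)}T_{u_F}h_F$ with $h_F\in H_{n,\varpi_\ell}$. Define $\Psi_T\in H_n$ recursively: for a single column $C\in B(\varpi_\ell)$, $\Psi_C=t^{\ell(u_C)}(T_{u_C^{-1}})^{-1}\mathbf 1_{\varpi_\ell}$; for $T=C\otimes S$ with $C\in B(\varpi_\ell)$ and $S\in B(\varpi_{\ell_r})\otimes\cdots\otimes B(\varpi_{\ell_1})$, $\ell_r\le\ell$, write $\Psi_S=\sum_{E\in B(\varpi_\ell)}T_{u_E}h_{E,S}$ with $h_{E,S}\in H_{n,\varpi_\ell}$ and set $\Psi_T=t^{\ell(u_C)}(T_{u_C^{-1}})^{-1}h_{C,S}$.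 *)

(* Defs.v *)
From HB Require Import structures.
From mathcomp Require Import all_boot all_order all_fingroup all_algebra.
From mathcomp Require Import zify.
From Stdlib Require Import ClassicalEpsilon.
Set Implicit Arguments.
Unset Strict Implicit.
Unset Printing Implicit Defensive.
Import GRing.Theory.
Local Open Scope ring_scope.

(* Indices: [n] = {1..n} is represented by 'I_n = {0..n-1};
   the simple transposition s_i (i in [n-1]) is indexed by i : 'I_n.-1 and
   swaps the ordinals lo i (value i) and hi i (value i+1). *)
Lemma lo_lt n (i : 'I_n.-1) : (i < n)%N.
Proof. have := ltn_ord i; lia. Qed.
Lemma hi_lt n (i : 'I_n.-1) : (i.+1 < n)%N.
Proof. have := ltn_ord i; lia. Qed.
Definition lo n (i : 'I_n.-1) : 'I_n := Ordinal (lo_lt i).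
Definition hi n (i : 'I_n.-1) : 'I_n := Ordinal (hi_lt i).

Section SymGroup.
Variable n : nat.

Definition sgen (i : 'I_n.-1) : {perm 'I_n} := tperm (lo i) (hi i).

(* composition of permutations as functions: (pcomp u v) k = u (v k) *)
Definition pcomp (u v : {perm 'I_n}) : {perm 'I_n} := (v * u)%g.

Definition wprod (s : seq 'I_n.-1) : {perm 'I_n} :=
  foldr (fun i w => pcomp (sgen i) w) 1%g s.

Definition has_word_of_len (w : {perm 'I_n}) (k : nat) : bool :=
  [exists s : k.-tuple 'I_n.-1, wprod s == w].

Definition clen (w : {perm 'I_n}) : nat :=
  match excluded_middle_informative (exists k, has_word_of_len w k) with
  | left h => ex_minn h
  | right _ => 0%N
  end.

Definition redword (w : {perm 'I_n}) : seq 'I_n.-1 :=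
  epsilon (inhabits [::]) (fun s => wprod s = w /\ size s = clen w).

Definition pact (w : {perm 'I_n}) (mu : 'I_n -> int) : 'I_n -> int :=
  fun i => mu ((w^-1)%g i).

Definition stab (mu : 'I_n -> int) : {set {perm 'I_n}} :=
  [set w : {perm 'I_n} | [forall i, pact w mu i == mu i]].

Definition varpi (k : nat) : 'I_n -> int := fun i => ((i < k)%N : nat)%:Z.

(* a column C = (c_1 < ... < c_l) is identified with the subset {c_1,...,c_l};
   colseq C = (c_1,...,c_l) in increasing order *)
Definition colseq (C : {set 'I_n}) : seq 'I_n := [seq x <- enum 'I_n | x \in C].
Definition cocolseq (C : {set 'I_n}) : seq 'I_n := [seq x <- enum 'I_n | x \notin C].

Definition uC (C : {set 'I_n}) : {perm 'I_n} :=
  odflt 1%g [pick u : {perm 'I_n} |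
              [forall k, u k == nth k (colseq C ++ cocolseq C) k]].

(* semistandardness: rows weakly increase from left to right; a tableau is the
   list [:: C_r; ...; C_1] of its columns from left to right *)
Definition colle (L R : {set 'I_n}) : bool :=
  [forall k : 'I_n, (k < #|R|)%N ==>
     (nth k (colseq L) k <= nth k (colseq R) k)%N].
Definition semistandard (T : seq {set 'I_n}) : bool := sorted colle T.

(* T in B(varpi_{l_r}) (x) ... (x) B(varpi_{l_1}) with 1 <= l_1 <= ... <= l_r <= n *)
Definition is_tensor_tableau (T : seq {set 'I_n}) : bool :=
  all (fun C : {set 'I_n} => (0 < #|C|)%N) T &&
  sorted (fun a b => b <= a)%N [seq #|C| | C : {set 'I_n} <- T].

Definition tshape (T : seq {set 'I_n}) : 'I_n -> int :=
  fun i => \sum_(C <- (T : seq {set 'I_n})) varpi #|(C : {set 'I_n})| i.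

Definition inB (lam : 'I_n -> int) (T : seq {set 'I_n}) : bool :=
  [&& is_tensor_tableau T, [forall i, tshape T i == lam i] & semistandard T].

Definition dominant_nonneg (lam : 'I_n -> int) : Prop :=
  (forall i, 0 <= lam i) /\ (forall i j : 'I_n, (i <= j)%N -> lam j <= lam i).

End SymGroup.

Section Hecke.
(* The affine Hecke algebra is handled through its universal property: A is any
   R-algebra (R commutative, t a unit of R) containing elements T_i, X_i^{+-1}
   satisfying the defining relations of H and in which the T_w are linearly
   independent over R (as they are in H). *)
Variables (n : nat) (R : comUnitRingType) (t : R) (A : algType R).
Variables (T : 'I_n.-1 -> A) (X Xi : 'I_n -> A).

Definition affine_hecke_relations : Prop :=
  (forall i, T i * T i = (t - 1) *: T i + t%:A) /\
  (forall i j : 'I_n.-1, (i.+1 = j)%N -> T i * T j * T i = T j * T i * T j) /\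
  (forall i j : 'I_n.-1, (i.+1 < j)%N || (j.+1 < i)%N -> T i * T j = T j * T i) /\
  (forall i j, X i * X j = X j * X i) /\
  (forall i, X i * Xi i = 1 /\ Xi i * X i = 1) /\
  (forall i, T i * X (lo i) * T i = t *: X (hi i)) /\
  (forall (i : 'I_n.-1) (j : 'I_n), j != lo i -> j != hi i -> T i * X j = X j * T i).

Definition Tw (w : {perm 'I_n}) : A := \prod_(i <- redword w) T i.

Definition Tw_free : Prop :=
  forall c : {perm 'I_n} -> R, \sum_w c w *: Tw w = 0 -> forall w, c w = 0.

Definition Tinv (i : 'I_n.-1) : A := t^-1 *: (T i + (1 - t)%:A).
Definition Twinv (w : {perm 'I_n}) : A := \prod_(i <- rev (redword w)) Tinv i.

Definition one_par (lam : 'I_n -> int) : A := \sum_(w in stab lam) Tw w.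
Definition one0 : A := \sum_(w : {perm 'I_n}) Tw w.

Definition inHpar (lam : 'I_n -> int) (h : A) : Prop :=
  exists c : {perm 'I_n} -> R, h = \sum_(w in stab lam) c w *: Tw w.

(* the (unique) decomposition h = sum_{F in B(varpi_l)} T_{u_F} h_F *)
Definition decomp (l : nat) (h : A) : {set 'I_n} -> A :=
  epsilon (inhabits (fun _ => 0))
    (fun f : {set 'I_n} -> A => (forall F : {set 'I_n}, #|F| = l -> inHpar (@varpi n l) (f F)) /\
              h = \sum_(F : {set 'I_n} | #|F| == l) Tw (uC F) * f F).

Fixpoint Psi (Tab : seq {set 'I_n}) : A :=
  match Tab with
  | [::] => one0
  | C :: Rest =>
      match Rest with
      | [::] => t ^+ clen (uC C) *: Twinv (uC C)^-1 * one_par (@varpi n #|C|)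
      | _ :: _ => t ^+ clen (uC C) *: Twinv (uC C)^-1 * decomp #|C| (Psi Rest) C
      end
  end.

Definition Xpow (mu : 'I_n -> int) : A :=
  \prod_(i < n) (if 0 <= mu i then X i ^+ `|mu i|%N else Xi i ^+ `|mu i|%N).
Definition XC (C : {set 'I_n}) : A := \prod_(i <- colseq C) X i.
Definition XT (Tab : seq {set 'I_n}) : A := \prod_(C <- Tab) XC C.

End Hecke.

(* Main.v *)
Require Import Defs.
From HB Require Import structures.
From mathcomp Require Import all_boot all_order all_fingroup all_algebra.
From mathcomp Require Import zify.
From Stdlib Require Import ClassicalEpsilon.
Set Implicit Arguments.
Unset Strict Implicit.
Unset Printing Implicit Defensive.
Import GRing.Theory.
Local Open Scope ring_scope.

(** The relation T_i X_i = t X_{i+1} T_i^{-1}, applied along a chain of columns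
    D -> s_i D with i in D and i+1 not in D, gives
    T_{u_E} X^{varpi_l} = X^E t^{l(u_E)} (T_{u_E^{-1}})^{-1}, and X^{varpi_l}
    commutes with H_{n,varpi_l}.  Multiplying Psi_T = sum_E T_{u_E} h_E by
    X^{varpi_l} therefore yields (b).

    For (a), the same chains show that Psi_{C' (x) S} is supported on those T_w
    for which w([l']) is below C' in the Gale order (l' the length of C').  The
    coefficient h_{C, C' (x) S} only sees the w with w([l]) = C, and w([l'])
    is contained in w([l]) as l' <= l, so C is entrywise below C' unless
    h_{C, C' (x) S} vanishes.  Iterating (b) and discarding the zero terms
    gives (c).

    Matsumoto's theorem makes T_w independent of the reduced word that defines
    it; lengths are computed as numbers of inversions.  Products of
    permutations read from left to right, so s_i w is [w * sgen i]. *)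

(** * Reduced words *)

Section Words.
Variable n : nat.
Implicit Types (i j : 'I_n.-1) (a b k : 'I_n) (w u v : {perm 'I_n}).
Implicit Types s : seq 'I_n.-1.
Local Open Scope nat_scope.

Lemma sgenE i a : sgen i a =
  (if a == i :> nat then i.+1 else if a == i.+1 :> nat then (i : nat) else a) :> nat.
Proof.
rewrite /sgen; case: tpermP => [->|->|] /=; rewrite ?eqxx //.
  by case: ifP => // /eqP; lia.
move=> h1 h2; case: ifP => [/eqP h|_]; first by case: h1; apply: val_inj.
by case: ifP => [/eqP h|//]; case: h2; apply: val_inj.
Qed.

Lemma sgen_id i a : a != i :> nat -> a != i.+1 :> nat -> sgen i a = a.
Proof. by move=> h1 h2; apply: val_inj; rewrite /= sgenE (negbTE h1) (negbTE h2). Qed.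

Lemma sgenK i : involutive (sgen i).
Proof. exact: tpermK. Qed.

Lemma sgenV i : ((sgen i)^-1)%g = sgen i.
Proof. exact: tpermV. Qed.

Lemma sgen_lo i : sgen i (lo i) = hi i.
Proof. exact: tpermL. Qed.

Lemma sgen_hi i : sgen i (hi i) = lo i.
Proof. exact: tpermR. Qed.

Lemma mulg_sgenK w i : (w * sgen i * sgen i = w)%g.
Proof. by rewrite -{2}(sgenV i) mulgK. Qed.

Lemma invMsgen w i a : ((w * sgen i)^-1)%g a = (w^-1)%g (sgen i a).
Proof. by rewrite invMg permM sgenV. Qed.

Lemma sgenC i j : (i.+1 < j) -> (sgen i * sgen j = sgen j * sgen i)%g.
Proof.
move=> h; apply/permP => a; rewrite !permM; apply: val_inj => /=.
by rewrite !sgenE; do !case: eqP => //=; lia.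
Qed.

Lemma sgen_braid i j : i.+1 = j ->
  (sgen i * sgen j * sgen i = sgen j * sgen i * sgen j)%g.
Proof.
move=> h; apply/permP => a; rewrite !permM; apply: val_inj => /=.
by rewrite !sgenE; do !case: eqP => //=; lia.
Qed.

(** Left descent: i+1 stands before i in the one-line notation of [w], so that multiplying by s_i on
    the left shortens [w]. *)
Definition descent w i : bool := (w^-1)%g (hi i) < (w^-1)%g (lo i).

Lemma descent_sgen w i : descent (w * sgen i)%g i = ~~ descent w i.
Proof.
rewrite /descent !invMsgen sgen_lo sgen_hi -leqNgt [RHS]leq_eqVlt.
case: eqP => // /val_inj /perm_inj /(congr1 val) /=; lia.
Qed.

Definition inversions w : {set 'I_n * 'I_n} :=
  [set p : 'I_n * 'I_n | (p.1 < p.2) && ((w^-1)%g p.2 < (w^-1)%g p.1)].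

Definition ninv w := #|inversions w|.

(** Apart from (i, i+1), s_i reverses the order of no pair, so applying it to both members turns the
    other inversions of [w * sgen i] into inversions of [w]. *)
Lemma card_inversions_sgen w i :
  #|inversions (w * sgen i)%g :\ (lo i, hi i)| = #|inversions w :\ (lo i, hi i)|.
Proof.
suff le u : #|inversions (u * sgen i)%g :\ (lo i, hi i)| <= #|inversions u :\ (lo i, hi i)|.
  by apply/eqP; rewrite eqn_leq le /= -{1}(mulg_sgenK w i) le.
pose f (p : 'I_n * 'I_n) := (sgen i p.1, sgen i p.2).
have fI : injective f by move=> [a b] [c d] [] /perm_inj -> /perm_inj ->.
rewrite -(card_imset _ fI); apply: subset_leq_card; apply/subsetP => _ /imsetP[[a b] h ->].
move: h; rewrite !inE /= !invMsgen => /and3P[h1 h2 h3]; rewrite h3 andbT.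
apply/andP; split.
  apply: contraNneq h1 => -[/(congr1 (sgen i)) + /(congr1 (sgen i))].
  rewrite !sgenK sgen_lo sgen_hi => ? ?; subst a b; move: h2 => /=; lia.
have {h1} : ~~ ((a == i :> nat) && (b == i.+1 :> nat)).
  apply: contra h1 => /andP[/eqP ha /eqP hb].
  by apply/eqP; congr pair; apply: val_inj.
by rewrite !sgenE; do !case: eqP => //=; lia.
Qed.

Lemma ninv_sgen w i : ~~ descent w i -> ninv (w * sgen i)%g = (ninv w).+1.
Proof.
move=> h; rewrite /ninv (cardsD1 (lo i, hi i)) [RHS](congr1 S (cardsD1 (lo i, hi i) _)).
rewrite card_inversions_sgen !inE /= ltnSn /= -/(descent w i) (negbTE h).
by rewrite -/(descent (w * sgen i)%g i) descent_sgen h.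
Qed.

Lemma ninv_descent w i : descent w i -> ninv w = (ninv (w * sgen i)%g).+1.
Proof. by move=> h; rewrite -{1}(mulg_sgenK w i) ninv_sgen // descent_sgen negbK. Qed.

Lemma ninv_sgen_le w i : ninv (w * sgen i)%g <= (ninv w).+1.
Proof.
case: (boolP (descent w i)) => [/ninv_descent|/ninv_sgen]; lia.
Qed.

(** Induction down from n-1 gives p a <= a, and induction up from 0 gives a <= p a. *)
Lemma perm_mono1 (p : {perm 'I_n}) :
  (forall i, p (lo i) < p (hi i)) -> p = 1%g.
Proof.
move=> h; apply/permP => a; rewrite perm1; apply: val_inj => /=; apply/eqP.
have step (b c : 'I_n) : c = b.+1 :> nat -> p b < p c.
  move=> e; have hb : b < n.-1 by have := ltn_ord c; lia.
  by have := h (Ordinal hb); congr (p _ < p _); apply: val_inj.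
rewrite eqn_leq; apply/andP; split.
  have [m] := ubnP (n - a); elim: m a => // m IH a hm.
  case: (ltnP a.+1 n) => ha; last by have := ltn_ord (p a); lia.
  have := step a (Ordinal ha) erefl; have := IH (Ordinal ha) => /=; lia.
have [m] := ubnP a; elim: m a => // m IH a hm.
case: (posnP a) => [-> //|ha].
have ha' : a.-1 < n by have := ltn_ord a; lia.
have := step (Ordinal ha') a; have := IH (Ordinal ha') => /=; lia.
Qed.

Lemma descent_exists w : w != 1%g -> exists i, descent w i.
Proof.
move=> h; apply/existsP; apply: contraR h; rewrite negb_exists => /forallP h.
rewrite -invg_eq1; apply/eqP; apply: perm_mono1 => i.
have := h i; rewrite /descent -leqNgt leq_eqVlt => /orP[/eqP|//].
by move=> /val_inj /perm_inj /(congr1 val) /=; lia.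
Qed.

Lemma wprod_cons i s : wprod (i :: s) = (wprod s * sgen i)%g.
Proof. by []. Qed.

Lemma wprod_rcons s i : wprod (rcons s i) = (sgen i * wprod s)%g.
Proof.
elim: s => [|j s IH]; first by rewrite /= /pcomp mulg1; apply/permP => a; rewrite permM perm1.
by rewrite rcons_cons !wprod_cons IH mulgA.
Qed.

Lemma wprod_rev s : wprod (rev s) = ((wprod s)^-1)%g.
Proof.
elim: s => [|i s IH]; first by rewrite invg1.
by rewrite rev_cons wprod_rcons IH wprod_cons invMg sgenV.
Qed.

Lemma ninv1 : ninv 1 = 0.
Proof.
apply: eq_card0 => -[a b]; rewrite !inE /= invg1 !perm1; lia.
Qed.

Lemma ninv_wprod s : ninv (wprod s) <= size s.
Proof.
elim: s => [|i s IH]; first by rewrite ninv1.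
by rewrite wprod_cons (leq_trans (ninv_sgen_le _ _)).
Qed.

Definition reduced_word w s := wprod s = w /\ size s = ninv w.

Lemma reduced_cons w i s : descent w i ->
  reduced_word (w * sgen i)%g s -> reduced_word w (i :: s).
Proof.
move=> /ninv_descent h [h1 h2]; split; first by rewrite wprod_cons h1 mulg_sgenK.
by rewrite /= h2 h.
Qed.

Lemma reduced_word_exists w : exists s, reduced_word w s.
Proof.
have [m] := ubnP (ninv w); elim: m w => // m IH w hm.
case: (eqVneq w 1%g) => [->|/descent_exists[i di]].
  by exists [::]; split; rewrite ?ninv1.
have [|s hs] := IH (w * sgen i)%g; first by have := ninv_descent di; lia.
by exists (i :: s); apply: reduced_cons.
Qed.

(** The product of k generators has at most k inversions, and removing descents one at a time
    attains this bound. *)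
Lemma clenE w : clen w = ninv w.
Proof.
rewrite /clen; have [s [h1 h2]] := reduced_word_exists w.
case: excluded_middle_informative => [h|[]]; last first.
  by exists (size s); apply/existsP; exists (in_tuple s); apply/eqP.
case: ex_minnP => m /existsP[r /eqP hr] hm; apply/eqP; rewrite eqn_leq.
rewrite -{2}hr -{3}(size_tuple r) ninv_wprod andbT -h2; apply: hm.
by apply/existsP; exists (in_tuple s); apply/eqP.
Qed.

Lemma redwordP w : reduced_word w (redword w).
Proof.
rewrite /reduced_word -clenE /redword.
apply: (epsilon_spec (inhabits [::]) (fun s => wprod s = w /\ size s = clen w)).
by have [s hs] := reduced_word_exists w; exists s; rewrite clenE.
Qed.

(** Reversing a reduced word inverts its product, which bounds the inversions of the inverse. *)
Lemma ninvV w : ninv (w^-1)%g = ninv w.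
Proof.
suff le u : ninv (u^-1)%g <= ninv u.
  by apply/eqP; rewrite eqn_leq le /= -{1}(invgK w) le.
have [h1 h2] := redwordP u.
by rewrite -h2 -{1}h1 -wprod_rev -size_rev ninv_wprod.
Qed.

Lemma reduced_behead w i s : reduced_word w (i :: s) ->
  descent w i /\ reduced_word (w * sgen i)%g s.
Proof.
move=> [h1 h2]; have e : wprod s = (w * sgen i)%g by rewrite -h1 wprod_cons mulg_sgenK.
have := ninv_wprod s; rewrite e => hle; move: h2 => /= h2.
case: (boolP (descent w i)) => [/ninv_descent hd|/ninv_sgen]; last lia.
by split=> //; split=> //; lia.
Qed.

End Words.

(** * Independence of the reduced word *)

Section Matsumoto.
Variables (n : nat) (R : pzRingType) (f : 'I_n.-1 -> R).
Hypothesis braid : forall i j : 'I_n.-1, (i.+1 = j)%N -> f i * f j * f i = f j * f i * f j.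
Hypothesis comm : forall i j : 'I_n.-1, (i.+1 < j)%N || (j.+1 < i)%N -> f i * f j = f j * f i.

(** Induction on length. If the first letters i and j differ, both are descents, so [w] also has
    reduced words that start with i, respectively j, and differ by one braid or commutation move;
    the induction hypothesis links each given word to one of these. *)
Lemma matsumoto (w : {perm 'I_n}) (s1 s2 : seq 'I_n.-1) :
  reduced_word w s1 -> reduced_word w s2 ->
  \prod_(i <- s1) f i = \prod_(i <- s2) f i.
Proof.
have [m] := ubnP (ninv w); elim: m w s1 s2 => // m IH w s1 s2 hm r1 r2.
case: s1 s2 r1 r2 => [|i a] [|j b] //; try by move=> [_ /= h1] [_ /= h2]; move: h1 h2; lia.
move=> /reduced_behead[di ra] /reduced_behead[dj rb].
have [hni hnj] := (ninv_descent di, ninv_descent dj).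
wlog lij : i j a b di dj ra rb hni hnj / (i <= j)%N.
  move=> W; case: (leqP i j) => h; first exact: W.
  by symmetry; apply: W => //; apply: ltnW.
rewrite !big_cons; move: lij; rewrite leq_eqVlt => /orP[/eqP/val_inj e|].
  by subst j; congr (_ * _); apply: (IH (w * sgen i)%g) => //; lia.
rewrite leq_eqVlt => /orP[/eqP e|e].
  have elh : hi i = lo j by apply: val_inj.
  (* [x] is what remains of [w] once the longest element s_i s_j s_i of the subgroup generated by
     s_i and s_j is split off. *)
  pose x := (w * sgen i * sgen j * sgen i)%g.
  have ex : x = (w * sgen j * sgen i * sgen j)%g.
    by rewrite /x -!mulgA [(sgen i * _)%g]mulgA (sgen_braid e) !mulgA.
  have si_hj : sgen i (hi j) = hi j.
    by rewrite sgen_id //=; lia.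
  have sj_li : sgen j (lo i) = lo i.
    by rewrite sgen_id //=; lia.
  (* The two descents say that i, i+1, i+2 occur in reverse order in [w]; the four descents below
     follow from this. *)
  move: (di) (dj); rewrite {1 2}/descent elh => hi' hj'.
  have d1 : descent (w * sgen i)%g j.
    rewrite /descent !invMsgen si_hj -elh sgen_hi; exact: ltn_trans hj' hi'.
  have d2 : descent (w * sgen i * sgen j)%g i.
    by rewrite /descent !invMsgen sj_li sgen_lo elh sgen_lo si_hj.
  have d3 : descent (w * sgen j)%g i.
    rewrite /descent !invMsgen sj_li elh sgen_lo; exact: ltn_trans hj' hi'.
  have d4 : descent (w * sgen j * sgen i)%g j.
    by rewrite /descent !invMsgen si_hj sgen_hi -elh sgen_hi elh sj_li.
  have [c rc] := reduced_word_exists x.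
  have ra' : reduced_word (w * sgen i)%g [:: j, i & c] by do 2!apply: reduced_cons => //.
  have rb' : reduced_word (w * sgen j)%g [:: i, j & c].
    by do 2!apply: reduced_cons => //; rewrite -ex.
  rewrite (IH _ _ _ _ ra ra'); last lia.
  rewrite (IH _ _ _ _ rb rb'); last lia.
  by rewrite !big_cons !mulrA braid.
(* Here j > i+1, so s_i does not touch the pair (j, j+1), nor s_j the pair (i, i+1). *)
have d1 : descent (w * sgen i)%g j.
  rewrite /descent !invMsgen; rewrite !sgen_id //=; lia.
have d2 : descent (w * sgen j)%g i.
  rewrite /descent !invMsgen; rewrite !sgen_id //=; lia.
have [c rc] := reduced_word_exists (w * sgen i * sgen j)%g.
have ra' : reduced_word (w * sgen i)%g (j :: c) by apply: reduced_cons.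
have rb' : reduced_word (w * sgen j)%g (i :: c).
  by apply: reduced_cons => //; rewrite -mulgA -sgenC // mulgA.
rewrite (IH _ _ _ _ ra ra'); last lia.
rewrite (IH _ _ _ _ rb rb'); last lia.
by rewrite !big_cons !mulrA comm // e.
Qed.

End Matsumoto.

(** * Columns and cosets *)

Section Columns.
Variable n : nat.
Implicit Types (i j : 'I_n.-1) (a b k : 'I_n) (w u v : {perm 'I_n}).
Implicit Types (C D E : {set 'I_n}) (l : nat).
Local Open Scope nat_scope.

Definition base_col l : {set 'I_n} := [set k : 'I_n | k < l].

Lemma card_base_col l : l <= n -> #|base_col l| = l.
Proof.
move=> h; rewrite cardsE -sum1_card /=.
by rewrite -(big_ord_widen n (fun=> 1) h) sum1_card card_ord.
Qed.

Lemma card_col_le C : #|C| <= n.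
Proof. by rewrite -[n in _ <= n]card_ord max_card. Qed.

(** A down-closed C containing x contains everything up to x, hence at least x+1 elements; so C lies
    in the initial segment of its own size. *)
Lemma down_closed_base_col C :
  (forall i, hi i \in C -> lo i \in C) -> C = base_col #|C|.
Proof.
move=> h; apply/eqP; rewrite eqEcard card_base_col ?card_col_le // leqnn andbT.
have down (x : 'I_n) m (y : 'I_n) : x = y + m :> nat -> x \in C -> y \in C.
  elim: m x => [|m IH] x e xC; first by rewrite (_ : y = x) //; apply: val_inj; rewrite /= e addn0.
  have hx : x.-1 < n.-1 by have := ltn_ord x; lia.
  apply: (IH (lo (Ordinal hx))); first by rewrite /= e addnS.
  by apply: h; rewrite (_ : hi _ = x) //; apply: val_inj => /=; lia.
apply/subsetP => x xC; rewrite inE -[x.+1]card_base_col ?ltn_ord //.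
apply: subset_leq_card; apply/subsetP => y; rewrite inE ltnS => hy.
by apply: (down x (x - y)) => //; lia.
Qed.

Lemma in_sgen_imset i C a : (a \in sgen i @: C) = (sgen i a \in C).
Proof. by rewrite -{1}(sgenK i a) mem_imset //; apply: perm_inj. Qed.

Lemma card_sgen_imset i C : #|sgen i @: C| = #|C|.
Proof. by rewrite card_imset //; apply: perm_inj. Qed.

(** Every column of length l arises from the highest weight column by moves that raise one entry i
    to i+1; the induction is on the sum of the entries. *)
Lemma column_ind l (P : {set 'I_n} -> Prop) : P (base_col l) ->
    (forall D i, #|D| = l -> lo i \in D -> hi i \notin D -> P D -> P (sgen i @: D)) ->
  forall C, #|C| = l -> P C.
Proof.
move=> Pb PS C; have [m] := ubnP (\sum_(x in C) x); elim: m C => // m IH C hm hC.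
case: (boolP [forall i, (hi i \in C) ==> (lo i \in C)]) => [/forallP h|].
  by rewrite (down_closed_base_col (fun i => implyP (h i))) hC.
rewrite negb_forall => /existsP[i]; rewrite negb_imply => /andP[hi_in lo_out].
(* Lowering the entry i+1 of [C] to i decreases the sum, and s_i undoes it. *)
pose D := sgen i @: C.
have eD : C = sgen i @: D.
  by rewrite -imset_comp -[LHS]imset_id; apply: eq_imset => x /=; rewrite sgenK.
have cD : #|D| = l by rewrite card_sgen_imset.
rewrite eD; apply: PS => //; rewrite ?in_sgen_imset ?sgen_lo ?sgen_hi //.
apply: IH => //; apply: leq_trans (hm : _ <= m).
rewrite /D big_imset /=; last by move=> x y _ _; apply: perm_inj.
rewrite (bigD1 (hi i)) //= [X in _ < X](bigD1 (hi i)) //= sgen_hi /=.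
rewrite addSn ltnS leq_add2l; apply: leq_sum => x /andP[xC xh].
rewrite sgenE; case: eqP => [e|_]; last by case: eqP => // ->.
by move: lo_out; rewrite (_ : lo i = x) ?xC //; apply: val_inj.
Qed.

(** * Minimal coset representatives *)

Lemma colseqE C : colseq C = enum C.
Proof. by rewrite /colseq enumT. Qed.

Lemma cocolseqE C : cocolseq C = enum (~: C).
Proof. by rewrite /cocolseq enumT; apply: eq_filter => x; rewrite /= inE. Qed.

Lemma sorted_enum C : sorted ltn [seq val x | x <- enum C].
Proof.
rewrite -colseqE /colseq sorted_map; apply: sorted_filter.
  by move=> x y z; apply: ltn_trans.
by rewrite -sorted_map val_enum_ord iota_ltn_sorted.
Qed.

Lemma nth_enum_ltn C k k' : k < k' -> k' < #|C| -> nth k (enum C) k < nth k' (enum C) k'.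
Proof.
move=> h h'; have hs := sorted_enum C.
rewrite (set_nth_default k) ?cardE -?cardE //.
have hk : k < #|C| by apply: ltn_trans h'.
rewrite -!(nth_map k (val k) val) -?cardE //.
by apply: (sorted_ltn_nth ltn_trans (val k) hs) => //; rewrite ?inE ?size_map -?cardE.
Qed.

(** The minimal representative of its coset: it maps the first #|C| positions onto C and increases
    on these and on the remaining positions. *)
Definition coset_rep C u :=
  (forall k, (u k \in C) = (k < #|C|)) /\
  (forall k k', k < k' -> (k < #|C|) = (k' < #|C|) -> u k < u k').

Lemma uCP C : coset_rep C (uC C).
Proof.
pose s := colseq C ++ cocolseq C.
have ss : size s = n by rewrite size_cat colseqE cocolseqE -!cardE cardsC card_ord.
have us : uniq s.
  rewrite cat_uniq colseqE cocolseqE !enum_uniq andbT /=.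
  by apply/hasPn => x; rewrite !mem_enum inE.
(* Injectivity makes the search in [uC] succeed, so its default [1] is never returned. *)
have inj : injective (fun k : 'I_n => nth k s k).
  move=> a b; rewrite (set_nth_default b) ?ss ?ltn_ord // => /eqP.
  by rewrite nth_uniq ?ss ?ltn_ord // => /eqP /val_inj.
have uE k : uC C k = nth k s k.
  rewrite /uC; case: pickP => [u /forallP h|/(_ (perm inj)) /negP[]]; first exact/eqP/h.
  by apply/forallP => x; rewrite permE.
have low k : k < #|C| -> uC C k = nth k (enum C) k.
  by move=> h; rewrite uE nth_cat colseqE -cardE h.
have hc : #|~: C| = n - #|C| by rewrite cardsCs setCK card_ord.
have hlt k : k - #|C| < n by apply: leq_ltn_trans (leq_subr _ _) (ltn_ord k).
have high k : #|C| <= k ->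
    uC C k = nth (Ordinal (hlt k)) (enum (~: C)) (Ordinal (hlt k)).
  move=> h; rewrite uE nth_cat colseqE cocolseqE -cardE ltnNge h /=.
  by apply: set_nth_default; rewrite -cardE hc /= ltn_sub2r // (leq_ltn_trans h).
split=> [k|k k' lk].
  case: ltnP => h.
    by rewrite low // -mem_enum mem_nth // -cardE.
  rewrite high // -[LHS]negbK -in_setC -mem_enum mem_nth // -cardE hc /=.
  by rewrite ltn_sub2r // (leq_ltn_trans h).
case: (ltnP k' #|C|) => h' h; first by rewrite !low // nth_enum_ltn.
have {}h : #|C| <= k by rewrite leqNgt h.
by rewrite !high // nth_enum_ltn //= ?hc ltn_sub2r // ?(leq_ltn_trans h lk) ?(leq_ltn_trans h').
Qed.

Lemma coset_rep_mono C u : coset_rep C u -> forall a b,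
  (a \in C) = (b \in C) -> a < b -> (u^-1)%g a < (u^-1)%g b.
Proof.
move=> [h1 h2] a b; have := permKV u b; have := permKV u a.
move: ((u^-1)%g a) ((u^-1)%g b) => x y <- <-; rewrite !h1 => e lt.
rewrite ltnNge leq_eqVlt; apply/norP; split.
  by apply/eqP => /val_inj e'; move: lt; rewrite e' ltnn.
by apply/negP => /h2 /(_ (esym e)); rewrite ltnNge ltnW.
Qed.

(** The map sending k to v^{-1}(u(k)) increases at each adjacent pair of positions: within a block
    since [u] and v^{-1} are monotone there, across the boundary since blocks are preserved. Hence
    it is the identity. *)
Lemma coset_rep_uniq C u v : coset_rep C u -> coset_rep C v -> u = v.
Proof.
move=> hu hv; apply/eqP; rewrite eq_mulgV1; apply/eqP; apply: perm_mono1 => i.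
rewrite !permM; have [[u1 u2] [v1 v2]] := (hu, hv).
case: (eqVneq (lo i < #|C|) (hi i < #|C|)) => [e|ne].
  by apply: (coset_rep_mono hv); [rewrite !u1 e|apply: u2].
have [hl hh] : lo i < #|C| /\ #|C| <= hi i by move: ne => /=; lia.
apply: (@leq_trans #|C|); first by rewrite -v1 permKV u1.
by rewrite leqNgt -v1 permKV u1 -leqNgt.
Qed.

Lemma uC_uniq C u : coset_rep C u -> uC C = u.
Proof. by apply: coset_rep_uniq; apply: uCP. Qed.

Lemma uC_base l : l <= n -> uC (base_col l) = 1%g.
Proof.
move=> h; apply: uC_uniq; split=> [k|k k' ? _]; rewrite ?perm1 //.
by rewrite inE card_base_col.
Qed.

(** Since i and i+1 lie on different sides of D, swapping them keeps the order within D and within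
    its complement. *)
Lemma uC_sgen D i : lo i \in D -> hi i \notin D ->
  uC (sgen i @: D) = (uC D * sgen i)%g.
Proof.
move=> hl hh; have [u1 u2] := uCP D.
apply: uC_uniq; split=> [k|k k' lk]; rewrite card_sgen_imset !permM.
  by rewrite in_sgen_imset sgenK u1.
move=> e; have := u2 _ _ lk e; move: e; rewrite -!u1.
set a := uC D k; set b := uC D k' => e lab; rewrite !sgenE.
have ha : a \in D -> a != i.+1 :> nat.
  by move=> h; apply: contraNneq hh => ea; rewrite (_ : hi i = a) //; apply: val_inj.
have ha' : a \notin D -> a != i :> nat.
  by move=> h; apply: contraNneq h => ea; rewrite (_ : a = lo i) //; apply: val_inj.
have hb : b \in D -> b != i.+1 :> nat.
  by move=> h; apply: contraNneq hh => ea; rewrite (_ : hi i = b) //; apply: val_inj.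
have hb' : b \notin D -> b != i :> nat.
  by move=> h; apply: contraNneq h => ea; rewrite (_ : b = lo i) //; apply: val_inj.
move: e ha ha' hb hb'; case: (a \in D) => <- /= ha ha' hb hb'.
  by move: (ha isT) (hb isT); do !case: eqP; lia.
by move: (ha' isT) (hb' isT); do !case: eqP; lia.
Qed.

Lemma stab_varpiP l w :
  reflect (forall k, (w k < l) = (k < l)) (w \in stab (@varpi n l)).
Proof.
rewrite inE; apply: (iffP forallP) => h k.
  have := h (w k); rewrite /pact /varpi permK => /eqP[].
  by case: (k < l); case: (w k < l).
by rewrite /pact /varpi -{2}(permKV w k) h.
Qed.

Lemma imset_base_stab l v E : #|E| = l ->
  ((v * uC E)%g @: base_col l == E) = (v \in stab (@varpi n l)).
Proof.
move=> cE; have [u1 _] := uCP E; rewrite cE in u1.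
have eqE k : (v * uC E)%g k \in E = (v k < l) by rewrite permM u1.
apply/eqP/stab_varpiP => [h k|h].
  by rewrite -eqE -{2}h mem_imset ?inE //; apply: perm_inj.
apply/setP => x; rewrite -{1}(permKV (v * uC E)%g x) mem_imset; last exact: perm_inj.
by rewrite inE -h -eqE permKV.
Qed.

(* The parabolic decomposition w = u_E v, with E = w([l]). *)
Lemma sum_cosets (V : zmodType) l (G : {perm 'I_n} -> V) : l <= n ->
  (\sum_w G w = \sum_(E : {set 'I_n} | #|E| == l)
                 \sum_(v in stab (@varpi n l)) G (v * uC E)%g)%R.
Proof.
move=> hl.
rewrite (partition_big (fun w : {perm 'I_n} => w @: base_col l) (fun E => #|E| == l)) /=; last first.
  by move=> w _; rewrite card_imset ?card_base_col //; apply: perm_inj.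
apply: eq_bigr => E /eqP cE.
rewrite (reindex (fun v => (v * uC E)%g)) /=; last first.
  by exists (fun v => (v * (uC E)^-1)%g) => v _; rewrite ?mulgK ?mulgKV.
by apply: eq_bigl => v; rewrite imset_base_stab.
Qed.

(** * The Gale order on columns *)

Definition cnt C (m : nat) := #|[set x in C | x < m]|.

(* On columns of equal length this is the entrywise order E <= C. *)
Definition gale E C := forall m, cnt C m <= cnt E m.

Lemma cnt_leq C m m' : m <= m' -> cnt C m <= cnt C m'.
Proof.
move=> h; apply: subset_leq_card; apply/subsetP => x; rewrite !inE => /andP[-> /=] hx.
exact: leq_trans hx h.
Qed.

Lemma cnt_sub C D m : C \subset D -> cnt C m <= cnt D m.
Proof.
move=> h; apply: subset_leq_card; apply/subsetP => x; rewrite !inE => /andP[hx ->].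
by rewrite (subsetP h).
Qed.

Lemma cnt_sgen i C m : m != i.+1 -> cnt (sgen i @: C) m = cnt C m.
Proof.
move=> hm; rewrite /cnt -[RHS](card_sgen_imset i); apply: eq_card => x.
rewrite in_sgen_imset !inE in_sgen_imset; congr (_ && _).
by rewrite sgenE; do !case: eqP => /=; lia.
Qed.

Lemma cnt_sgen_lo D i : hi i \notin D -> cnt (sgen i @: D) i.+1 = cnt D i.
Proof.
move=> h; rewrite -[RHS](@cnt_sgen i) ?neq_ltn ?ltnSn //; apply: eq_card => x.
rewrite !inE in_sgen_imset ltnS leq_eqVlt; case: eqP => //= e.
by rewrite (_ : x = lo i) ?sgen_lo ?(negbTE h) //; apply: val_inj.
Qed.

Lemma gale_sgenr E D i : hi i \notin D -> gale E D -> gale E (sgen i @: D).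
Proof.
move=> h g m; case: (eqVneq m i.+1) => [->|ne]; last by rewrite cnt_sgen.
by rewrite cnt_sgen_lo // (leq_trans (g _)) // cnt_leq.
Qed.

(** The counts change only at i+1, where cnt D i <= cnt E i still suffices; nothing is assumed about
    how i and i+1 sit in E. *)
Lemma gale_sgen E D i : hi i \notin D -> gale E D -> gale (sgen i @: E) (sgen i @: D).
Proof.
move=> h g m; case: (eqVneq m i.+1) => [->|ne]; last by rewrite !cnt_sgen.
by rewrite cnt_sgen_lo // (leq_trans (g _)) // -(@cnt_sgen i) ?cnt_leq // neq_ltn ltnSn.
Qed.

Lemma cntE C m : cnt C m = count (fun x => x < m) [seq val x | x <- enum C].
Proof.
rewrite count_map /cnt cardsE cardE /enum_mem size_filter count_filter.
by apply: eq_count => x; rewrite /= andbC.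
Qed.

(** If the k-th entry c of C were below the k-th entry of E, then, counting from 0, C would have k+1
    entries below c+1 and E at most k. *)
Lemma gale_colle E C : #|C| <= #|E| -> gale E C -> colle E C.
Proof.
move=> hc g; apply/forallP => k; apply/implyP => hk.
have hk' := leq_trans hk hc.
rewrite !colseqE leqNgt; apply/negP => lt.
have := g (nth k (enum C) k).+1; apply/negP; rewrite -ltnNge !cntE.
rewrite -!(nth_map k (val k) val) -?cardE // in lt *.
set sC := [seq val x | x <- enum C] in lt *; set sE := [seq val x | x <- enum E] in lt *.
have [kC kE] : k < size sC /\ k < size sE by rewrite !size_map -!cardE.
have := Order.PreorderTheory.count_le_nth (val k) (sorted_enum C : sorted <%O%O sC) kC.
have := Order.PreorderTheory.count_lt_nth (val k) (sorted_enum E : sorted <%O%O sE) kE.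
move=> h1 h2.
apply: (@leq_trans k.+1); last by rewrite -h2; apply/eq_leq/eq_count => x; rewrite /= ltnS.
rewrite ltnS -[X in _ <= X]h1; apply: sub_count => x /=; rewrite ltnS => hx.
exact: leq_ltn_trans hx lt.
Qed.

End Columns.

(** * The Hecke algebra *)

(** A single factor can be pulled to the front because the factors commute, although the ring need
    not be commutative. *)
Lemma prod_comm_rem (R : pzRingType) (I : eqType) (F : I -> R) (r : seq I) (P : pred I) (x : I) :
    (forall a b, F a * F b = F b * F a) -> uniq r -> x \in r -> P x ->
  \prod_(j <- r | P j) F j = F x * \prod_(j <- r | P j && (j != x)) F j.
Proof.
move=> FC; elim: r => // a r IH /= /andP[ar ur]; rewrite inE !big_cons.
case: (eqVneq a x) => [<- _ Pa|ne /= xr Px].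
  rewrite Pa /=; congr (_ * _); rewrite big_seq_cond [RHS]big_seq_cond.
  apply: eq_bigl => j; case: (boolP (j \in r)) => //= jr.
  by rewrite (_ : j != a) ?andbT //; apply: contraNneq ar => <-.
by rewrite IH // andbT; case: (P a) => //; rewrite mulrA FC -mulrA.
Qed.

Section Hecke.
Variables (n : nat) (R : comUnitRingType) (t : R) (A : algType R).
Variables (T : 'I_n.-1 -> A) (X Xi : 'I_n -> A).
Hypothesis t_unit : t \is a GRing.unit.
Hypothesis HT : affine_hecke_relations t T X Xi.
Implicit Types (i j : 'I_n.-1) (w u v : {perm 'I_n}) (C D E : {set 'I_n}).
Implicit Types (S : seq {set 'I_n}) (h : A).

Local Notation Tw := (Tw T).
Local Notation Tinv := (Tinv t T).
Local Notation Twinv := (Twinv t T).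
Local Notation XC := (XC X).
Local Notation Psi := (Psi t T).
Local Notation stabv l := (stab (@varpi n l)).

Let T2 i : T i * T i = (t - 1) *: T i + t%:A.
Proof. by case: HT. Qed.
Let XX (a b : 'I_n) : X a * X b = X b * X a.
Proof. by case: HT => _ [_ [_ [h _]]]. Qed.
Let TX i : T i * X (lo i) * T i = t *: X (hi i).
Proof. by case: HT => _ [_ [_ [_ [_ [h _]]]]]. Qed.
Let TXc i (a : 'I_n) : a != lo i -> a != hi i -> T i * X a = X a * T i.
Proof. by case: HT => _ [_ [_ [_ [_ [_ h]]]]]; apply: h. Qed.

Lemma Tw_reduced w s : reduced_word w s -> Tw w = \prod_(i <- s) T i.
Proof.
case: HT => _ [br [co _]]; apply: matsumoto => //; exact: redwordP.
Qed.

Lemma Tw1 : Tw 1 = 1.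
Proof. by rewrite (@Tw_reduced _ [::]) ?big_nil //; split; rewrite ?ninv1. Qed.

Lemma Tw_sgen w i : ~~ descent w i -> Tw (w * sgen i)%g = T i * Tw w.
Proof.
move=> h; rewrite (@Tw_reduced _ (i :: redword w)) ?big_cons //.
apply: reduced_cons; first by rewrite descent_sgen.
by rewrite mulg_sgenK; apply: redwordP.
Qed.

Lemma T_Tw_descent w i : descent w i ->
  T i * Tw w = (t - 1) *: Tw w + t *: Tw (w * sgen i)%g.
Proof.
move=> h; have e : Tw w = T i * Tw (w * sgen i)%g.
  by rewrite -{1}(mulg_sgenK w i) Tw_sgen // descent_sgen h.
by rewrite {1}e mulrA T2 mulrDl -!scalerAl mul1r -e.
Qed.

Lemma T_Tinv i : T i * Tinv i = 1.
Proof.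
rewrite /Defs.Tinv -scalerAr mulrDr T2 -scalerAr mulr1 addrAC -scalerDl.
by rewrite addrC -[1 - t]opprB addrC subrr scale0r add0r scalerA mulVr // scale1r.
Qed.

Lemma Tinv_T i : Tinv i * T i = 1.
Proof.
rewrite /Defs.Tinv -scalerAl mulrDl T2 -scalerAl mul1r addrAC -scalerDl.
by rewrite addrC -[1 - t]opprB addrC subrr scale0r add0r scalerA mulVr // scale1r.
Qed.

Lemma scale_Tinv i : t *: Tinv i = T i + (1 - t)%:A.
Proof. by rewrite /Defs.Tinv scalerA mulrV // scale1r. Qed.

Lemma Tw_Twinv w : Tw w * Twinv w = 1.
Proof.
rewrite /Defs.Tw /Defs.Twinv; elim: (redword w) => [|i s IH]; first by rewrite !big_nil mulr1.
rewrite rev_cons -cats1 big_cat big_seq1 big_cons /=.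
by rewrite mulrA -(mulrA (T i)) IH mulr1 T_Tinv.
Qed.

Lemma Twinv_Tw w : Twinv w * Tw w = 1.
Proof.
rewrite /Defs.Tw /Defs.Twinv; elim: (redword w) => [|i s IH]; first by rewrite !big_nil mulr1.
rewrite rev_cons -cats1 big_cat big_seq1 big_cons /=.
by rewrite mulrA -(mulrA _ (Tinv i)) Tinv_T mulr1 IH.
Qed.

(** Lengths add in v^{-1} s_i, so T_{v^{-1} s_i} = T_{v^{-1}} T_i; take inverses. *)
Lemma Twinv_sgen v i : ~~ descent v i ->
  Twinv ((v * sgen i)^-1)%g = Tinv i * Twinv (v^-1)%g.
Proof.
move=> h; have [r1 r2] := redwordP (v^-1)%g.
have e : Tw ((v * sgen i)^-1)%g = Tw (v^-1)%g * T i.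
  rewrite (@Tw_reduced _ (rcons (redword (v^-1)%g) i)) -?cats1 ?big_cat ?big_seq1 //.
  rewrite cats1; split; first by rewrite wprod_rcons r1 invMg sgenV.
  by rewrite size_rcons r2 !ninvV ninv_sgen.
rewrite -[LHS]mulr1 -(Tw_Twinv (v^-1)%g) -[Tw (v^-1)%g]mulr1 -(T_Tinv i).
by rewrite !mulrA -(mulrA _ _ (T i)) -e Twinv_Tw mul1r.
Qed.

(** The left factor t^{l(u_C)} (T_{u_C^{-1}})^{-1} of [Psi] for a tableau with first column C. *)
Definition colU C : A := t ^+ clen (uC C) *: Twinv ((uC C)^-1)%g.

Lemma colU_base l : (l <= n)%N -> colU (base_col n l) = 1.
Proof.
move=> h; rewrite /colU uC_base // invg1 clenE ninv1 expr0 scale1r.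
by have := Tw_Twinv 1%g; rewrite Tw1 mul1r.
Qed.

(** In u_D v the elements of D occupy the first #|D| positions, so i stands before i+1. *)
Lemma not_descent_coset v D i : v \in stabv #|D| -> lo i \in D -> hi i \notin D ->
  ~~ descent (v * uC D)%g i.
Proof.
move=> /stab_varpiP hv hl hh; have [u1 _] := uCP D.
have h k : ((v * uC D)%g k \in D) = (k < #|D|)%N by rewrite permM u1 hv.
rewrite /descent -leqNgt ltnW //; apply: (@leq_trans #|D|).
  by rewrite -h permKV.
by rewrite leqNgt -h permKV.
Qed.

Lemma not_descent_uC D i : lo i \in D -> hi i \notin D -> ~~ descent (uC D) i.
Proof.
rewrite -[uC D]mul1g; apply: not_descent_coset.
by apply/stab_varpiP => k; rewrite perm1.
Qed.

(** The length grows by one, and the new factor t turns T_i^{-1} into T_i + 1 - t. *)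
Lemma colU_sgen D i : lo i \in D -> hi i \notin D ->
  colU (sgen i @: D) = (T i + (1 - t)%:A) * colU D.
Proof.
move=> hl hh; have nd := not_descent_uC hl hh.
rewrite /colU uC_sgen // !clenE ninv_sgen // Twinv_sgen // -scale_Tinv exprSr.
by move: (Tinv i) => Z; rewrite -scalerA -scalerAr -scalerAl.
Qed.

(** Along a chain of columns, each s_i lengthens both u_D and u_D v. *)
Lemma Tw_uC v E : v \in stabv #|E| -> Tw (v * uC E)%g = Tw (uC E) * Tw v.
Proof.
have := card_col_le E; move cE: #|E| => l hl hv.
move: E cE; apply: (column_ind (P := fun E => Tw (v * uC E)%g = Tw (uC E) * Tw v)).
  by rewrite uC_base // mulg1 Tw1 mul1r.
move=> D i cD hlo hhi IH.
rewrite uC_sgen // mulgA !Tw_sgen ?not_descent_uC //; last by rewrite not_descent_coset ?cD.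
by rewrite IH mulrA.
Qed.

(** * Moving T_w past monomials *)

Lemma XCE C : XC C = \prod_(a in C) X a.
Proof. by rewrite /Defs.XC /colseq big_filter enumT [index_enum _]unlock. Qed.

Lemma XC_D1 C a : a \in C -> XC C = X a * XC (C :\ a).
Proof.
move=> h; rewrite !XCE (prod_comm_rem (x := a)) ?index_enum_uniq ?mem_index_enum //.
by congr (_ * _); apply: eq_bigl => b; rewrite !inE andbC.
Qed.

Lemma T_XC_notin i C : lo i \notin C -> hi i \notin C -> T i * XC C = XC C * T i.
Proof.
move=> hl hh; rewrite !XCE; apply: commr_prod => a aC.
by apply: TXc; apply: contraTneq aC => ->.
Qed.

Lemma T_Xlo i : T i * X (lo i) = t *: (X (hi i) * Tinv i).
Proof. by rewrite -[LHS]mulr1 -(T_Tinv i) mulrA TX -scalerAl. Qed.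

Lemma Xlo_T i : X (lo i) * T i = t *: (Tinv i * X (hi i)).
Proof. by rewrite -[LHS]mul1r -(Tinv_T i) -mulrA [T i * _]mulrA TX; move: (Tinv i) => Z; rewrite -scalerAr. Qed.

Lemma hi_neq_lo i : hi i != lo i.
Proof. by apply/eqP => /(congr1 val) /=; lia. Qed.

(** The case of i and i+1 both in C rests on T_i X_i X_{i+1} = t X_{i+1} T_i^{-1} X_{i+1} = X_{i+1}
    X_i T_i. *)
Lemma T_XC i C : (lo i \in C) = (hi i \in C) -> T i * XC C = XC C * T i.
Proof.
case: (boolP (lo i \in C)) => hl hh; last by rewrite T_XC_notin // -hh.
rewrite (XC_D1 hl) (@XC_D1 (C :\ lo i) (hi i)); last by rewrite !inE hi_neq_lo -hh.
set Z := XC _; have hZ : T i * Z = Z * T i by rewrite T_XC_notin // !inE eqxx ?andbF.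
rewrite -!mulrA -hZ !mulrA; congr (_ * _).
rewrite T_Xlo; transitivity (X (hi i) * (t *: (Tinv i * X (hi i)))).
  by move: (Tinv i) => Y; rewrite -scalerAl -scalerAr mulrA.
by rewrite -Xlo_T mulrA [X (hi i) * _]XX.
Qed.

Lemma Tw_XC_base l v : v \in stabv l ->
  Tw v * XC (base_col n l) = XC (base_col n l) * Tw v.
Proof.
have [m] := ubnP (ninv v); elim: m v => // m IH v hm hv.
case: (eqVneq v 1%g) => [->|/descent_exists[i di]]; first by rewrite Tw1 mulr1 mul1r.
have hv' := elimT (stab_varpiP l v) hv.
have vV k : (((v^-1)%g k < l) = (k < l))%N by rewrite -hv' permKV.
(* A descent of [v] cannot straddle the boundary of [l], as v^{-1} preserves [l] and its complement;
   so s_i lies in the stabiliser as well. *)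
have hlh : (lo i < l)%N = (hi i < l)%N.
  by have := vV (lo i); have := vV (hi i); move: di; rewrite /descent /=; lia.
have hvi : (v * sgen i)%g \in stabv l.
  apply/stab_varpiP => k; rewrite permM -(hv' k).
  by move: hlh; rewrite sgenE /=; do !case: eqP => /=; lia.
rewrite -(mulg_sgenK v i) Tw_sgen ?descent_sgen ?di // -mulrA IH //.
  by rewrite !mulrA T_XC // !inE.
by have := ninv_descent di; lia.
Qed.

Lemma Tw_uC_XC E : Tw (uC E) * XC (base_col n #|E|) = XC E * colU E.
Proof.
have := card_col_le E; move cE: #|E| => l hl.
move: E cE; apply: (column_ind (P := fun E => Tw (uC E) * XC (base_col n l) = XC E * colU E)).
  by rewrite uC_base // colU_base // Tw1 mulr1 mul1r.
move=> D i cD hlo hhi IH.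
have hsi : hi i \in sgen i @: D by rewrite in_sgen_imset sgen_hi.
have eD : (sgen i @: D) :\ hi i = D :\ lo i.
  apply/setP => a; rewrite !inE in_sgen_imset.
  case: (eqVneq a (hi i)) => [->|nh] /=; first by rewrite hi_neq_lo (negbTE hhi).
  case: (eqVneq a (lo i)) => [->|nl] /=; first by rewrite sgen_lo (negbTE hhi).
  by rewrite sgen_id.
rewrite uC_sgen // Tw_sgen ?not_descent_uC // -mulrA IH colU_sgen // mulrA.
(* T_i X_i = t X_{i+1} T_i^{-1} trades the factor X_i for X_{i+1}; [Z], the product over the common
   entries, commutes with T_i. *)
rewrite (XC_D1 hlo) (XC_D1 hsi) eD -scale_Tinv; set Z := XC _.
have hZ : T i * Z = Z * T i by rewrite T_XC_notin // !inE ?eqxx ?(negbTE hhi) ?andbF.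
have hZ' : Tinv i * Z = Z * Tinv i.
  by rewrite /Defs.Tinv -scalerAl -scalerAr mulrDl mulrDr hZ mulr_algl mulr_algr.
rewrite !mulrA T_Xlo; congr (_ * _).
by move: (Tinv i) hZ' => Y hZ'; rewrite -!scalerAr -scalerAl -!mulrA hZ'.
Qed.

(** * Supports with respect to the T_w *)

Definition spanT (P : {perm 'I_n} -> Prop) h :=
  exists2 c : {perm 'I_n} -> R, (forall w, c w != 0 -> P w) & h = \sum_w c w *: Tw w.

Lemma spanT0 P : spanT P 0.
Proof.
exists (fun=> 0) => [w|]; first by rewrite eqxx.
by rewrite big1 // => w _; rewrite scale0r.
Qed.

Lemma spanTD P h h' : spanT P h -> spanT P h' -> spanT P (h + h').
Proof.
move=> [c hc ->] [c' hc' ->]; exists (fun w => c w + c' w) => [w|].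
  case: (eqVneq (c w) 0) => [->|nz _]; last exact: hc.
  by rewrite add0r; apply: hc'.
by rewrite -big_split; apply: eq_bigr => w _; rewrite scalerDl.
Qed.

Lemma spanTZ P (a : R) h : spanT P h -> spanT P (a *: h).
Proof.
move=> [c hc ->]; exists (fun w => a * c w) => [w|].
  by case: (eqVneq (c w) 0) => [->|nz _]; [rewrite mulr0 eqxx|apply: hc].
by rewrite scaler_sumr; apply: eq_bigr => w _; rewrite scalerA.
Qed.

Lemma spanT_Tw (P : {perm 'I_n} -> Prop) w : P w -> spanT P (Tw w).
Proof.
move=> h; exists (fun v => (v == w)%:R) => [v|].
  by case: (eqVneq v w) => [->//|_]; rewrite eqxx.
rewrite (bigD1 w) //= eqxx scale1r big1 ?addr0 // => v /negbTE ->.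
by rewrite scale0r.
Qed.

Lemma spanT_sum P (I : finType) (Q : pred I) (F : I -> A) :
  (forall x, Q x -> spanT P (F x)) -> spanT P (\sum_(x | Q x) F x).
Proof. by move=> h; apply: big_ind; [apply: spanT0|apply: spanTD|]. Qed.

Lemma spanT_sub (P Q : {perm 'I_n} -> Prop) h :
  (forall w, P w -> Q w) -> spanT P h -> spanT Q h.
Proof. by move=> PQ [c hc ->]; exists c => // w /hc /PQ. Qed.

(** T_i T_w is a combination of T_w and T_{s_i w}. *)
Lemma spanT_T (P Q : {perm 'I_n} -> Prop) i h :
    (forall w, P w -> Q w) -> (forall w, P w -> Q (w * sgen i)%g) ->
  spanT P h -> spanT Q (T i * h).
Proof.
move=> PQ PQ' [c hc ->]; rewrite mulr_sumr; apply: spanT_sum => w _.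
case: (eqVneq (c w) 0) => [->|/hc Pw]; first by rewrite scale0r mulr0; apply: spanT0.
rewrite -scalerAr; apply: spanTZ; case: (boolP (descent w i)) => [d|nd].
  rewrite T_Tw_descent //; apply: spanTD; apply: spanTZ; apply: spanT_Tw; last exact: PQ'.
  exact: PQ.
by rewrite -Tw_sgen //; apply: spanT_Tw; apply: PQ'.
Qed.

Definition below_column C w := gale (w @: base_col n #|C|) C.

Lemma imset_mul_sgen w i C : (w * sgen i)%g @: C = sgen i @: (w @: C).
Proof. by rewrite -imset_comp; apply: eq_imset => x; rewrite permM. Qed.

(** At the highest weight column every w in the support fixes [l]. Each step multiplies by T_i + 1 -
    t, which keeps w or replaces it by s_i w, and both stay below s_i D. *)
Lemma colU_span C h : inHpar T (@varpi n #|C|) h -> spanT (below_column C) (colU C * h).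
Proof.
rewrite /below_column; have := card_col_le C; move cC: #|C| => l hl hh.
move: C cC; apply: (column_ind (P := fun C => spanT (fun w => gale (w @: base_col n l) C) (colU C * h)))
  => [|D i cD hlo hhi IH].
  rewrite colU_base // mul1r; case: hh => c ->; apply: spanT_sum => w hw.
  apply: spanTZ; apply: spanT_Tw.
  suff -> : w @: base_col n l = base_col n l by move=> m.
  have := imset_base_stab w (card_base_col hl).
  by rewrite uC_base // mulg1 hw => /eqP.
rewrite colU_sgen // -mulrA mulrDl mulr_algl; apply: spanTD.
  apply: spanT_T IH => w g; first exact: gale_sgenr.
  by rewrite imset_mul_sgen; apply: gale_sgen.
apply: spanTZ; apply: spanT_sub IH => w g; exact: gale_sgenr.
Qed.

(** * The components of Psi and their vanishing *)

Hypothesis T_free : Tw_free T.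

(** The coset decomposition shows that the choice made by [decomp] satisfies its specification, and
    linear independence of the T_w then determines its components. *)
Lemma decompE (c : {perm 'I_n} -> R) E :
  decomp T #|E| (\sum_w c w *: Tw w) E =
  \sum_(v in stabv #|E|) c (v * uC E)%g *: Tw v.
Proof.
set l := #|E|; set h := \sum_w _; have ln : (l <= n)%N by apply: card_col_le.
pose good (f : {set 'I_n} -> A) :=
  (forall F : {set 'I_n}, #|F| = l -> inHpar T (@varpi n l) (f F)) /\
  h = \sum_(F : {set 'I_n} | #|F| == l) Tw (uC F) * f F.
have ex : exists f, good f.
  exists (fun F => \sum_(v in stabv l) c (v * uC F)%g *: Tw v); split.
    by move=> F _; exists (fun v => c (v * uC F)%g).
  rewrite /h (sum_cosets _ ln); apply: eq_bigr => F /eqP cF.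
  rewrite mulr_sumr; apply: eq_bigr => v hv.
  by rewrite Tw_uC ?cF // -scalerAr.
have [f1 f2] : good (decomp T l h) by apply: epsilon_spec.
set f := decomp T l h in f1 f2 *.
pose d F := epsilon (inhabits (fun=> 0))
  (fun c : {perm 'I_n} -> R => f F = \sum_(w in stabv l) c w *: Tw w).
have dP (F : {set 'I_n}) : #|F| = l -> f F = \sum_(w in stabv l) d F w *: Tw w.
  by move=> cF; apply: (epsilon_spec (inhabits (fun=> 0))
    (fun c : {perm 'I_n} -> R => f F = \sum_(w in stabv l) c w *: Tw w)); apply: f1.
(* With w = u_F v and F = w([l]), [e] is the difference between the given coefficient of T_w and the
   one coming from the chosen decomposition. *)
pose e w := c w - d (w @: base_col n l) (w * (uC (w @: base_col n l))^-1)%g.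
have e_coset (F : {set 'I_n}) v : #|F| = l -> v \in stabv l -> e (v * uC F)%g = c (v * uC F)%g - d F v.
  by move=> cF hv; rewrite /e; move: (hv); rewrite -(imset_base_stab _ cF) => /eqP ->; rewrite mulgK.
have e0 : forall w, e w = 0.
  apply: T_free; rewrite (sum_cosets _ ln).
  transitivity (h - \sum_(F : {set 'I_n} | #|F| == l) Tw (uC F) * f F); last by rewrite -f2 subrr.
  rewrite /h (sum_cosets _ ln) -sumrB; apply: eq_bigr => F /eqP cF.
  rewrite dP // mulr_sumr -sumrB; apply: eq_bigr => v hv.
  by rewrite e_coset // scalerBl -scalerAr Tw_uC ?cF.
rewrite dP //; apply: eq_bigr => v hv; congr (_ *: _); apply/eqP.
by rewrite eq_sym -subr_eq0 -e_coset // e0.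
Qed.

Lemma one0E : one0 T = \sum_w 1 *: Tw w.
Proof. by apply: eq_bigr => w _; rewrite scale1r. Qed.

(** The single-column clause also fits the recursion: the empty tableau has Psi equal to the sum of
    all T_w, whose C-component is the sum over the stabiliser. *)
Lemma Psi_cons C S : Psi (C :: S) = colU C * decomp T #|C| (Psi S) C.
Proof.
case: S => //=; rewrite one0E decompE; congr (_ * _).
by apply: eq_bigr => w _; rewrite scale1r.
Qed.

Lemma Psi_cons_sum C S (c : {perm 'I_n} -> R) : Psi S = \sum_w c w *: Tw w ->
  Psi (C :: S) = colU C * \sum_(v in stabv #|C|) c (v * uC C)%g *: Tw v.
Proof. by move=> h; rewrite Psi_cons h decompE. Qed.

Lemma Psi_span S : spanT (fun w => if S is C :: _ then below_column C w else True) (Psi S).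
Proof.
elim: S => [|C S [c _ h]]; first by exists (fun=> 1); rewrite //= one0E.
rewrite (Psi_cons_sum C h); apply: colU_span; by eexists.
Qed.

Lemma Psi_cons0 C S : Psi S = 0 -> Psi (C :: S) = 0.
Proof.
move=> h; rewrite (@Psi_cons_sum C S (fun=> 0)).
  by rewrite big1 ?mulr0 // => w _; rewrite scale0r.
by rewrite h big1 // => w _; rewrite scale0r.
Qed.

Lemma Psi_not_colle C D S : (#|D| <= #|C|)%N -> ~~ colle C D -> Psi [:: C, D & S] = 0.
Proof.
move=> hDC; have [c hc h] := Psi_span (D :: S) => /negP nc.
rewrite (Psi_cons_sum C h) big1 ?mulr0 // => v hv.
case: (eqVneq (c (v * uC C)%g) 0) => [->|/hc g]; first by rewrite scale0r.
case: nc; apply: gale_colle => // m; apply: leq_trans (g m) _; apply: cnt_sub.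
(* For w = u_C v one has w([l]) = C, and it contains w([l']) with l' the length of [D]. *)
have /eqP {2}<- := etrans (imset_base_stab v (erefl #|C|)) hv.
by apply/imsetS/subsetP => k; rewrite !inE => /leq_trans; apply.
Qed.

Lemma Psi_not_semistandard S : is_tensor_tableau S -> ~~ semistandard S -> Psi S = 0.
Proof.
elim: S => // C [|D S] // IH /andP[/andP[_ h1] /andP[h2 h3]].
rewrite [semistandard _]/(colle C D && semistandard (D :: S)) negb_and => /orP[nc|ns]; first exact: Psi_not_colle.
by apply: Psi_cons0; apply: IH => //; apply/andP.
Qed.

(** In each term T_{u_C} T_v, first T_v commutes with the monomial, then T_{u_C} turns it into X^C
    times [colU C]. *)
Lemma Psi_XC_base S l : (l <= n)%N ->
  Psi S * XC (base_col n l) = \sum_(C : {set 'I_n} | #|C| == l) XC C * Psi (C :: S).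
Proof.
move=> hl; have [c _ h] := Psi_span S.
rewrite {1}h (sum_cosets _ hl) mulr_suml; apply: eq_bigr => C /eqP cC.
rewrite (Psi_cons_sum C h) mulrA -Tw_uC_XC cC mulr_suml mulr_sumr.
apply: eq_bigr => v hv.
by rewrite Tw_uC ?cC // -scalerAl -scalerAr -!mulrA Tw_XC_base.
Qed.

Lemma Xpow_varpi l : Xpow X Xi (@varpi n l) = XC (base_col n l).
Proof.
rewrite XCE big_mkcond; apply: eq_bigr => a _; rewrite inE /varpi.
by case: (a < l)%N.
Qed.

Lemma XpowD (lam mu : 'I_n -> int) : (forall a, 0 <= lam a) -> (forall a, 0 <= mu a) ->
  Xpow X Xi (fun a => lam a + mu a) = Xpow X Xi lam * Xpow X Xi mu.
Proof.
move=> hl hm; rewrite /Xpow -prodrM_comm.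
  apply: eq_bigr => a _; rewrite hl hm; have -> : 0 <= lam a + mu a by have := hl a; have := hm a; lia.
  by rewrite -exprD; congr (_ ^+ _); have := hl a; have := hm a; lia.
move=> a b _ _; rewrite hl hm; apply: commrX; apply/commr_sym; apply: commrX; exact: XX.
Qed.

Lemma XC_comm C D : XC C * XC D = XC D * XC C.
Proof.
rewrite !XCE; apply: commr_prod => a _; apply/commr_sym; apply: commr_prod => b _; exact: XX.
Qed.

Lemma XC_XT C S : XC C * XT X S = XT X S * XC C.
Proof. by apply: commr_prod => D _; apply: XC_comm. Qed.

End Hecke.

(** * Shapes of tableaux *)

Section Shapes.
Variable n : nat.
Implicit Types (C D : {set 'I_n}) (S : seq {set 'I_n}) (lam : 'I_n -> int).

Lemma tshape_cons C S i : tshape (C :: S) i = varpi #|C| i + tshape S i.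
Proof. by rewrite /tshape big_cons. Qed.

Lemma tshape_ge0 S i : 0 <= tshape S i.
Proof.
elim: S => [|C S IH]; first by rewrite /tshape big_nil.
by rewrite tshape_cons /varpi; lia.
Qed.

Lemma tshape_eq0 S (i : 'I_n) : all (fun C => #|C| <= i)%N S -> tshape S i = 0.
Proof.
elim: S => [|C S IH] /=; first by rewrite /tshape big_nil.
by move=> /andP[hC /IH h]; rewrite tshape_cons h /varpi ltnNge hC.
Qed.

(** For dominant [lam] this is [l] with l the length of the leftmost column of the diagram. *)
Definition supp lam : {set 'I_n} := [set i | 0 < lam i].

Lemma supp_base_col lam : dominant_nonneg lam -> supp lam = base_col n #|supp lam|.
Proof.
move=> [_ h]; apply: down_closed_base_col => i; rewrite !inE.
by have := h (lo i) (hi i) (leqnSn i); lia.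
Qed.

Lemma lt_card_supp lam (i : 'I_n) : dominant_nonneg lam -> (i < #|supp lam|)%N = (0 < lam i).
Proof. by move=> h; have := supp_base_col h => /setP/(_ i); rewrite !inE => ->. Qed.

(** The shape left after deleting the leftmost column. *)
Definition strip lam : 'I_n -> int := fun i => lam i - varpi #|supp lam| i.

Lemma stripE lam i : dominant_nonneg lam ->
  strip lam i = if 0 < lam i then lam i - 1 else lam i.
Proof. by move=> h; rewrite /strip /varpi lt_card_supp //; case: ifP; rewrite ?subr0. Qed.

Lemma strip_dominant lam : dominant_nonneg lam -> dominant_nonneg (strip lam).
Proof.
move=> h; have [h0 h1] := h; split=> [i|i j ij]; rewrite !stripE //.
  by have := h0 i; case: ifP; lia.
by have := h1 _ _ ij; do !case: ifP; lia.
Qed.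

(** The largest part counts the columns; truncated predecessor commutes with maxima and covers [lam]
    = 0. *)
Lemma max_strip lam : dominant_nonneg lam ->
  (\max_(i < n) `|strip lam i| = (\max_(i < n) `|lam i|).-1)%N.
Proof.
move=> h; rewrite (big_morph predn (op1 := maxn) (id1 := 0%N)) //; last by move=> x y; lia.
by apply: eq_bigr => i _; rewrite stripE //; have := h.1 i; case: ifP; lia.
Qed.

(** This is [inB] without semistandardness: (b) produces all such tableaux before (a) discards
    terms. *)
Definition tableau_of_shape lam S := is_tensor_tableau S && [forall i, tshape S i == lam i].

Lemma tableau_of_shape_cons lam C S : dominant_nonneg lam -> (0 < #|supp lam|)%N ->
  tableau_of_shape lam (C :: S) = tableau_of_shape (strip lam) S && (#|C| == #|supp lam|).
Proof.
move=> dl sl; apply/andP/andP.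
  move=> [/andP[/andP[c0 a0] hs] /forallP hsh].
  have le : all (fun D : {set 'I_n} => #|D| <= #|C|)%N S.
    have tr : transitive (fun a b => b <= a)%N by move=> x y z h1 h2; apply: leq_trans h2 h1.
    by have := order_path_min tr hs; rewrite all_map.
  have eC : supp lam = base_col n #|C|.
    apply/setP => i; rewrite !inE -(eqP (hsh i)) tshape_cons /varpi.
    case: ltnP => hi; first by have := tshape_ge0 S i; lia.
    by rewrite tshape_eq0 //; apply: sub_all le => D; move/leq_trans; apply.
  have cC : #|supp lam| = #|C| by rewrite eC card_base_col ?card_col_le.
  split; last by rewrite cC.
  apply/andP; split; first by apply/andP; split=> //; apply: path_sorted hs.
  apply/forallP => i; rewrite /strip cC -(eqP (hsh i)) tshape_cons.
  by apply/eqP; lia.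
move=> [/andP[/andP[a0 hs] /forallP hsh] /eqP cC]; split; last first.
  by apply/forallP => i; rewrite tshape_cons cC (eqP (hsh i)) /strip; apply/eqP; lia.
apply/andP; split; first by apply/andP; rewrite cC.
case: S a0 hs hsh => // D S /andP[D0 _] hs hsh.
apply/andP; split=> //.
(* In the last row of [D], of index #|D|-1, the stripped shape is positive, hence so is [lam]; thus
   [D] is no longer than the new column. *)
have hD : (#|D|.-1 < n)%N by have := card_col_le D; lia.
have := hsh (Ordinal hD); rewrite tshape_cons stripE // => /eqP.
have := tshape_ge0 S (Ordinal hD); rewrite /varpi /= prednK // leqnn.
have := lt_card_supp (Ordinal hD) dl; rewrite /= prednK // -cC => ->.
by case: ifP => //; lia.
Qed.

End Shapes.

(** * Iterating the one-column expansion *)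

Section Expansion.
Variables (n : nat) (R : comUnitRingType) (t : R) (A : algType R).
Variables (T : 'I_n.-1 -> A) (X Xi : 'I_n -> A).
Hypothesis t_unit : t \is a GRing.unit.
Hypothesis HT : affine_hecke_relations t T X Xi.
Hypothesis T_free : Tw_free T.

(** Induction on the number m of columns: expand for the stripped shape, then multiply on the right
    by the monomial of the longest column, which (b) prepends to each tableau. *)
Lemma one0_Xpow m (lam : 'I_n -> int) : dominant_nonneg lam -> (\max_(i < n) `|lam i| = m)%N ->
  one0 T * Xpow X Xi lam =
  \sum_(Tab : m.-tuple {set 'I_n} | tableau_of_shape lam Tab) XT X Tab * Psi t T Tab.
Proof.
elim: m lam => [|m IH] lam dl hm.
  (* Without columns only the empty tableau remains, and its Psi is [one0]. *)
  have l0 i : lam i = 0.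
    have : (`|lam i| <= 0)%N by rewrite -hm; apply: (leq_bigmax (F := fun i => `|lam i|%N)).
    lia.
  have -> : Xpow X Xi lam = 1 by rewrite /Xpow big1 // => i _; rewrite l0.
  rewrite (big_pred1 [tuple]) /=; first by rewrite /XT big_nil mulr1 mul1r.
  move=> S; rewrite tuple0 [RHS]eqxx; apply/andP; split=> //.
  by apply/forallP => i; rewrite l0 /tshape big_nil.
set l := #|supp lam|.
have l_gt0 : (0 < l)%N.
  rewrite lt0n; apply/eqP => l0.
  have : (\max_(i < n) `|lam i| <= 0)%N; last by rewrite hm.
  apply/bigmax_leqP => i _; have := lt_card_supp i dl; rewrite -/l l0.
  by have := dl.1 i; lia.
have -> : Xpow X Xi lam = Xpow X Xi (strip lam) * Xpow X Xi (@varpi n l).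
  rewrite -(XpowD t_unit HT).
  - by apply: eq_bigr => i _; rewrite subrK.
  - exact: (strip_dominant dl).1.
  - by [].
rewrite mulrA (IH _ (strip_dominant dl)) ?max_strip ?hm // Xpow_varpi mulr_suml.
(* A tableau with m+1 columns is a pair of its tail and its first column. *)
rewrite [RHS](reindex (fun p : m.-tuple {set 'I_n} * {set 'I_n} => [tuple of p.2 :: p.1])); last first.
  exists (fun S : m.+1.-tuple {set 'I_n} => ([tuple of behead S], thead S)) => [[S C] _|S _] /=.
    by congr pair; apply: val_inj.
  by rewrite [RHS]tuple_eta; apply: val_inj.
rewrite [RHS](eq_bigl (fun p : m.-tuple {set 'I_n} * {set 'I_n} =>
    tableau_of_shape (strip lam) p.1 && (#|p.2| == l))); last first.
  by move=> p; rewrite tableau_of_shape_cons.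
rewrite -(pair_big_dep (fun S : m.-tuple {set 'I_n} => tableau_of_shape (strip lam) S)
  (fun _ (C : {set 'I_n}) => #|C| == l) (fun S C => XT X (C :: S) * Psi t T (C :: S))).
apply: eq_bigr => S _; rewrite -mulrA (Psi_XC_base t_unit HT T_free) ?card_col_le // mulr_sumr.
by apply: eq_bigr => C _; rewrite mulrA -(XC_XT HT) /XT big_cons.
Qed.

End Expansion.

Theorem theorem5p2 (n : nat) (R : comUnitRingType) (t : R) (A : algType R)
    (T : 'I_n.-1 -> A) (X Xi : 'I_n -> A) :
  (0 < n)%N ->
  t \is a GRing.unit ->
  affine_hecke_relations t T X Xi ->
  Tw_free T ->
  (* (a) *)
  (forall Tab : seq {set 'I_n},
      (0 < size Tab)%N -> is_tensor_tableau Tab -> ~~ semistandard Tab ->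
      Psi t T Tab = 0) /\
  (* (b) *)
  (forall Tab : seq {set 'I_n},
      (0 < size Tab)%N -> is_tensor_tableau Tab ->
      forall l : nat, (1 <= l <= n)%N -> (#|head set0 Tab| <= l)%N ->
      Psi t T Tab * Xpow X Xi (@varpi n l) =
      \sum_(C : {set 'I_n} | #|C| == l) XC X C * Psi t T (C :: Tab)) /\
  (* (c) *)
  (forall lam : 'I_n -> int, dominant_nonneg lam ->
      one0 T * Xpow X Xi lam =
      \sum_(Tab : (\max_(i < n) `|lam i|%N).-tuple {set 'I_n} | inB lam Tab)
         XT X Tab * Psi t T Tab).
Proof.
move=> _ t_unit HT T_free; split; [|split].
- by move=> S _; apply: (Psi_not_semistandard t_unit HT T_free).
- move=> S _ _ l /andP[_ hl] _.
  by rewrite Xpow_varpi (Psi_XC_base t_unit HT T_free).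
move=> lam dl; rewrite (one0_Xpow t_unit HT T_free dl erefl).
rewrite [RHS](eq_bigl (fun S : _.-tuple _ => tableau_of_shape lam S && semistandard S)); last first.
  by move=> S; rewrite /inB /tableau_of_shape andbA.
(* By (a), the terms of tableaux that are not semistandard vanish. *)
rewrite [RHS]big_mkcondr; apply: eq_bigr => S /andP[hS _]; case: ifPn => // ns.
by rewrite (Psi_not_semistandard t_unit HT T_free) // mulr0.
Qed.
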